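(* Let $p,q,r$ be positive integers. In each of the following cases the complete tripartite graph $K_{p,q,r}$ is $S$-determined: (a) $p=q=r$; (b) $p,q,r$ are all powers of the same prime $a$; (c) $\max\{p,q,r\}$ is prime.
   Context: All graphs are finite and simple. For a graph $G$, the Seidel matrix is $S(G)=J-I-2A(G)$, where $A(G)$ is the adjacency matrix, $J$ the all-ones matrix and $I$ the identity; its eigenvalue multiset is the Seidel spectrum of $G$. For a partition $V(G)=U\cup W$, Seidel switching with respect to $U$ deletes all edges between $U$ and $W$ and adds an edge between $u\in U$, $w\in W$ whenever $uw$ was not an edge. Two graphs are switching equivalent if one is obtained from the other by a Seidel switching. A graph $G$ is $S$-determined if every graph with the same Seidel spectrum as $G$ is switching equivalent to a graph isomorphic to $G$. *)

(* Defs.v *)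
From mathcomp Require Import all_boot all_order all_algebra all_field.

Set Implicit Arguments.
Unset Strict Implicit.
Unset Printing Implicit Defensive.

Import GRing.Theory.
Local Open Scope ring_scope.

Record sgraph (V : finType) := SGraph {
  adj :> rel V;
  adj_sym : symmetric adj;
  adj_irr : irreflexive adj
}.

(* Rows and columns are indexed by the enumeration of the vertices; another    *)
(* enumeration conjugates the matrix by a permutation.                         *)
Definition adjacency_mx (V : finType) (G : sgraph V) : 'M[algC]_#|V| :=
  \matrix_(i, j) (adj G (enum_val i) (enum_val j))%:R.

Definition seidel_mx (V : finType) (G : sgraph V) : 'M[algC]_#|V| :=
  const_mx 1 - 1%:M - 2%:R *: adjacency_mx G.

(* The entries of a Seidel matrix are integers, so all its eigenvalues lie in  *)
(* algC.                                                                       *)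
Definition spectrum (n : nat) (M : 'M[algC]_n) : seq algC :=
  sval (closed_field_poly_normal (char_poly M)).

Lemma spectrumP (n : nat) (M : 'M[algC]_n) :
  char_poly M = \prod_(z <- spectrum M) ('X - z%:P).
Proof.
rewrite /spectrum; case: closed_field_poly_normal => s /= {1}->.
by rewrite (monicP (char_poly_monic M)) scale1r.
Qed.

(* Spectra are multisets, hence are compared up to permutation.                *)
Definition same_seidel_spectrum (V W : finType) (G : sgraph V) (H : sgraph W) :=
  perm_eq (spectrum (seidel_mx G)) (spectrum (seidel_mx H)).

Definition switch_adj (V : finType) (U : {set V}) (G : sgraph V) : rel V :=
  fun x y => if (x \in U) == (y \in U) then adj G x y else ~~ adj G x y.

Lemma switch_adj_sym (V : finType) (U : {set V}) (G : sgraph V) :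
  symmetric (switch_adj U G).
Proof. by move=> x y; rewrite /switch_adj eq_sym (adj_sym G). Qed.

Lemma switch_adj_irr (V : finType) (U : {set V}) (G : sgraph V) :
  irreflexive (switch_adj U G).
Proof. by move=> x; rewrite /switch_adj eqxx (adj_irr G). Qed.

(* The parts of the partition are U and its complement; U may be empty, so     *)
(* that every graph is switching equivalent to itself.                         *)
Definition switch (V : finType) (U : {set V}) (G : sgraph V) : sgraph V :=
  SGraph (switch_adj_sym U G) (switch_adj_irr U G).

Definition switching_equivalent (V : finType) (G H : sgraph V) : Prop :=
  exists U : {set V}, adj H =2 adj (switch U G).

Definition isomorphic (V W : finType) (G : sgraph V) (H : sgraph W) : Prop :=
  exists2 f : V -> W, bijective f & forall x y, adj H (f x) (f y) = adj G x y.

Definition S_determined (V : finType) (G : sgraph V) : Prop :=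
  forall (W : finType) (H : sgraph W), same_seidel_spectrum H G ->
  exists K : sgraph W, switching_equivalent H K /\ isomorphic K G.

Section CompleteTripartite.
Variables p q r : nat.

Definition tripartite_part (x : 'I_p + 'I_q + 'I_r) : nat :=
  match x with inl (inl _) => 0%N | inl (inr _) => 1%N | inr _ => 2%N end.

Definition tripartite_adj : rel ('I_p + 'I_q + 'I_r)%type :=
  fun x y => tripartite_part x != tripartite_part y.

Lemma tripartite_adj_sym : symmetric tripartite_adj.
Proof. by move=> x y; rewrite /tripartite_adj eq_sym. Qed.

Lemma tripartite_adj_irr : irreflexive tripartite_adj.
Proof. by move=> x; rewrite /tripartite_adj eqxx. Qed.

Definition complete_tripartite : sgraph ('I_p + 'I_q + 'I_r)%type :=
  SGraph tripartite_adj_sym tripartite_adj_irr.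

End CompleteTripartite.

(* Main.v *)
Require Import Defs.
From mathcomp Require Import all_boot all_order all_algebra all_fingroup all_field.
From mathcomp Require Import ring zify.

(** Adding the identity to a Seidel matrix gives a symmetric matrix M with
    entries 1 and -1 and unit diagonal. It is normal, so its rank and the trace
    of M^3 depend only on the spectrum. For K_{p,q,r} the rank is at most 3 and
    the trace of M^3 is n^3 - 12pqr. Conversely, if M has rank at most 3 and
    some triple of vertices has a negative product of entries, the three
    corresponding rows span the row space, and this forces every row to be plus
    or minus one of these three; so the graph is a switching of a complete
    tripartite graph K_{a,b,c}, with a+b+c = p+q+r and abc = pqr. In each of the
    three cases these equations determine the multiset {p,q,r}: either by the
    equality case of AM-GM, or because the two triples share an element, and
    then the other two elements have the same sum and product. *)

Set Implicit Arguments.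
Unset Strict Implicit.
Unset Printing Implicit Defensive.

Import Order.TTheory GRing.Theory Num.Theory.

(** * Triples with the same sum and product *)

(** [b] is a root of $(X-q)(X-r)$, because this polynomial is also $(X-b)(X-c)$. *)
Lemma perm_pair_sum_prod (q r b c : nat) :
  q + r = b + c -> q * r = b * c -> perm_eq [:: q; r] [:: b; c].
Proof.
move=> sE pE; have : (b == q) || (b == r) by nia.
case/orP=> /eqP eb; have ec : c = q + r - b by lia.
  by rewrite ec eb addKn.
by rewrite ec eb addnK; apply/seq.permP=> P /=; lia.
Qed.

Definition same_sum_prod (s t : seq nat) : Prop :=
  [/\ size s = 3, size t = 3, sumn s = sumn t &
      \prod_(x <- s) x = \prod_(x <- t) x].

Implicit Types s t : seq nat.

Lemma same_sum_prod_sym s t : same_sum_prod s t -> same_sum_prod t s.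
Proof. by case. Qed.

Lemma perm_same_sum_prod s s' t t' : perm_eq s s' -> perm_eq t t' ->
  same_sum_prod s t -> same_sum_prod s' t'.
Proof.
move=> ss' tt' [sz_s sz_t sE pE]; split.
- by rewrite -(perm_size ss').
- by rewrite -(perm_size tt').
- by rewrite -(perm_sumn ss') -(perm_sumn tt').
- by rewrite -(perm_big _ ss') -(perm_big _ tt').
Qed.

Lemma same_sum_prod_split s t x y : x \in s -> y \in t -> same_sum_prod s t ->
  exists q r b c, [/\ perm_eq s [:: x; q; r], perm_eq t [:: y; b; c],
    x + q + r = y + b + c & x * q * r = y * b * c].
Proof.
move=> /perm_to_rem xs /perm_to_rem yt.
move=> /(perm_same_sum_prod xs yt).
case: (rem x s) xs => [|q [|r [|? ?]]] xs [] //=.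
case: (rem y t) yt => [|b [|c [|? ?]]] yt //= _ _.
rewrite !big_cons !big_nil !muln1 !mulnA !addn0 !addnA => sE pE.
by exists q, r, b, c.
Qed.

Lemma perm_common_elt s t x : 0 < x -> x \in s -> x \in t ->
  same_sum_prod s t -> perm_eq s t.
Proof.
move=> x0 xs xt /(same_sum_prod_split xs xt)[q [r [b [c [ps pt sE pE]]]]].
rewrite (permPl ps) (permPr pt) perm_cons.
by apply: perm_pair_sum_prod; [lia|nia].
Qed.

Section AMGM.
Local Open Scope ring_scope.

Lemma amgm3_eq (R : realDomainType) (a b c : R) :
  0 <= a -> 0 <= b -> 0 <= c -> 0 < a + b + c ->
  (a + b + c) ^+ 3 = 27 * a * b * c -> a = b /\ b = c.
Proof.
move=> a0 b0 c0 s0 eq_s.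
pose S := (a - b) ^+ 2 + (b - c) ^+ 2.
have S0 : 0 <= S by rewrite addr_ge0 // sqr_ge0.
have S_le0 : (a + b + c) * S <= 0.
  (* This identity writes twice the AM-GM defect as a sum of nonnegative terms; at equality the
     first one vanishes, and [S] with it. *)
  have : (a + b + c) * S + ((a + b + c) * (c - a) ^+ 2
      + 6 * (a * (b - c) ^+ 2 + b * (c - a) ^+ 2 + c * (a - b) ^+ 2)) =
    2 * ((a + b + c) ^+ 3 - 27 * a * b * c) by rewrite /S; ring.
  rewrite eq_s subrr mulr0 => /eqP; rewrite addr_eq0 => /eqP ->.
  rewrite oppr_le0; apply: addr_ge0.
    by rewrite mulr_ge0 ?sqr_ge0 ?ltW.
  by apply: mulr_ge0 => //; rewrite !addr_ge0 // mulr_ge0 // sqr_ge0.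
have : S == 0 by rewrite eq_le S0 andbT -(pmulr_rle0 _ s0).
rewrite paddr_eq0 ?sqr_ge0 // !sqrf_eq0 !subr_eq0.
by case/andP=> /eqP -> /eqP ->.
Qed.

End AMGM.

Lemma perm_constant p t :
  same_sum_prod [:: p; p; p] t -> perm_eq [:: p; p; p] t.
Proof.
case: t => [|a [|b [|c [|? ?]]]] [] //= _ _.
rewrite !big_cons !big_nil !addn0 !muln1 => sE pE.
have [p0|p_gt0] := posnP p.
  by rewrite p0; have [-> -> ->] : [/\ a = 0, b = 0 & c = 0] by split; lia.
have sE3 : a + b + c = 3 * p by lia.
have := amgm3_eq (a := a%:Z) (b := b%:Z) (c := c%:Z).
case; [lia|lia|lia|lia| |].
  rewrite -!PoszD sE3 -mulrA -mulrA -!PoszM -pE !PoszM; ring.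
move=> [ab] [bc]; have [-> -> ->] : [/\ a = p, b = p & c = p] by split; lia.
by [].
Qed.

Lemma perm_prime_max m s t : prime m -> m \in s -> all (leq^~ m) s ->
  0 \notin s -> same_sum_prod s t -> perm_eq s t.
Proof.
move=> m_pr ms /allP s_le s_gt0 st.
have [_ _ _ pE] := st; have m0 := prime_gt0 m_pr.
have : m %| \prod_(x <- t) x by rewrite -pE (big_rem _ ms) dvdn_mulr.
rewrite Euclid_dvd_prod // big_has => /hasP[x xt /dvdnP[k xE]].
apply: (perm_common_elt m0 ms _ st).
have [q [r [b [c [ps pt sE' pE']]]]] := same_sum_prod_split ms xt st.
have q_in : q \in s by rewrite (perm_mem ps) !inE eqxx orbT.
have r_in : r \in s by rewrite (perm_mem ps) !inE eqxx !orbT.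
have q0 : 0 < q by rewrite lt0n; apply: contraNneq s_gt0 => <-.
have r0 : 0 < r by rewrite lt0n; apply: contraNneq s_gt0 => <-.
have := s_le q q_in; have := s_le r r_in => /= rm qm.
rewrite xE in xt sE' pE'.
have qrE : q * r = k * b * c by nia.
have kbc0 : 0 < k * b * c by rewrite -qrE muln_gt0 q0.
have [k1|k_gt1] := leqP k 1.
  by have k_eq1 : k = 1; [nia|rewrite k_eq1 mul1n in xt].
have k2 : k = 2.
  have b0 : 0 < b by move: kbc0; rewrite !muln_gt0 => /andP[/andP[]].
  (* [k * m < k * m + b + c = m + q + r <= 3 * m], since [b] is positive. *)
  have : k < 3 by rewrite -(ltn_pmul2r m0); lia.
  by lia.
exfalso; subst k.
(* (m - q)(m - r) >= 0 gives m(b + c) <= 2bc <= (b + c)^2 / 2, although b + c <= m. *)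
have h1 : (m - q) * (m - r) + m * (b + c) = 2 * b * c by nia.
have h2 : 4 * b * c <= (b + c) * (b + c) by nia.
have h3 : b + c <= m by lia.
nia.
Qed.

Definition power_of (a x : nat) := exists i, x = a ^ i.

(* Let x be the least of the six numbers, say in s. If x were not in t, dividing *)
(* by x would give 1 + a^k + a^l = y + b + c with a dividing y, b and c and with *)
(* a^k a^l = y b c; the sizes rule out a^k = 1 and a^l = 1, so a divides 1.      *)
Lemma perm_prime_powers a s t : prime a -> (forall x, x \in s -> power_of a x) ->
  same_sum_prod s t -> perm_eq s t.
Proof.
move=> a_pr s_pow st; have a0 := prime_gt0 a_pr.
have t_pow x : x \in t -> power_of a x.
  have [_ _ _ pE] := st; move=> xt.
  have [N prod_s] : power_of a (\prod_(x <- s) x).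
    elim: (s) s_pow => [|y u IHu] pow_u; first by exists 0; rewrite big_nil.
    have [|M uE] := IHu; first by move=> z zu; apply: pow_u; rewrite inE zu orbT.
    have [k yE] := pow_u y (mem_head _ _).
    by exists (k + M); rewrite big_cons uE yE expnD.
  have : x %| a ^ N by rewrite -prod_s pE (big_rem _ xt) dvdn_mulr.
  by case/dvdn_pfactor => // k _ ->; exists k.
have dvd_pow x y : power_of a x -> power_of a y -> x <= y -> exists k, y = x * a ^ k.
  move=> [k ->] [l ->]; rewrite leq_exp2l ?prime_gt1 // => /subnKC <-.
  by exists (l - k); rewrite expnD.
have pow1 k : a ^ k != 1 -> a %| a ^ k.
  by case: k => // k _; rewrite expnS dvdn_mulr.
(* Stated for arbitrary triples because the least element may lie in [s] or in [t]; it is applied in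
   both orders. *)
have min_in s1 t1 x : (forall y, y \in s1 -> power_of a y) ->
    (forall y, y \in t1 -> power_of a y) -> same_sum_prod s1 t1 ->
    x \in s1 -> (forall y, y \in s1 ++ t1 -> x <= y) -> x \in t1.
  move=> pow_s pow_t st1 xs xmin; apply: contraT => xt.
  have [y yt] : exists y, y \in t1.
    by case: st1 => _; case: (t1) => // y *; exists y; rewrite mem_head.
  have [q [r [b [c [ps pt sE pE]]]]] := same_sum_prod_split xs yt st1.
  have quot z : z \in s1 ++ t1 -> exists k, z = x * a ^ k.
    move=> z_in; apply: dvd_pow; [exact: pow_s| |exact: xmin].
    by move: z_in; rewrite mem_cat => /orP[]; auto.
  have x0 : 0 < x by have [k ->] := pow_s x xs; rewrite expn_gt0 a0.
  have quot_t z : z \in t1 -> exists2 k, z = x * k & a %| k.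
    move=> zt; have [|k zE] := quot z; first by rewrite mem_cat zt orbT.
    exists (a ^ k) => //; apply: pow1; apply: contraNneq xt => k1.
    by rewrite -[x]muln1 -k1 -zE.
  have [|k qE] := quot q; first by rewrite mem_cat (perm_mem ps) !inE eqxx orbT.
  have [|l rE] := quot r; first by rewrite mem_cat (perm_mem ps) !inE eqxx !orbT.
  have [y' yE dy] := quot_t y yt.
  have [|b' bE db] := quot_t b; first by rewrite (perm_mem pt) !inE eqxx orbT.
  have [|c' cE dc] := quot_t c.
    by rewrite (perm_mem pt) !inE eqxx !orbT.
  have sE' : 1 + a ^ k + a ^ l = y' + b' + c' by nia.
  have pE' : a ^ k * a ^ l = y' * b' * c'.
    have x3 : 0 < x * x * x by rewrite !muln_gt0 x0.
    apply/eqP; rewrite -(eqn_pmul2l x3); apply/eqP.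
    by move: pE; rewrite qE rE yE bE cE; lia.
  have ak : 0 < a ^ k by rewrite expn_gt0 a0.
  have al : 0 < a ^ l by rewrite expn_gt0 a0.
  have a1 := prime_gt1 a_pr.
  (* The cofactors [y'], [b'], [c'] are positive multiples of [a], hence at least 2, so their sum is
     at most their product. If [a ^ k] were 1, [sE'] would make that sum [2 + a ^ l], which exceeds
     the product [a ^ l]; likewise for [a ^ l]. *)
  have big : a ^ k * a ^ l + 2 > y' + b' + c'.
    have : 0 < y' * b' * c' by rewrite -pE' muln_gt0 ak.
    rewrite pE' !muln_gt0 => /andP[/andP[y0 b0] c0].
    have := leq_trans a1 (dvdn_leq y0 dy).
    have := leq_trans a1 (dvdn_leq b0 db).
    have := leq_trans a1 (dvdn_leq c0 dc).
    move=> c1 b1 y1; have add_le_mul m n : 1 < m -> 1 < n -> m + n <= m * n by nia.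
    have yb := add_le_mul _ _ y1 b1.
    by have := add_le_mul (y' * b') c' _ c1; lia.
  have k1 : a ^ k != 1 by apply/eqP => k1; rewrite k1 in sE' big; lia.
  have l1 : a ^ l != 1 by apply/eqP => l1; rewrite l1 in sE' big; lia.
  have : a %| 1.
    rewrite -(dvdn_addl _ (pow1 _ k1)) -(dvdn_addl _ (pow1 _ l1)) sE'.
    by rewrite !dvdn_add.
  by rewrite dvdn1 => /eqP a1'; rewrite a1' in a1.
have pos x : power_of a x -> 0 < x by move=> [k ->]; rewrite expn_gt0 a0.
have [x x_in x_min] : exists2 x, x \in s ++ t & forall y, y \in s ++ t -> x <= y.
  have : exists x, x \in s ++ t.
    by case: st; case: (s) => // x *; exists x; rewrite mem_head.
  by case/ex_minnP => x ? ?; exists x.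
have xst : x \in s /\ x \in t.
  move: (x_in); rewrite mem_cat => /orP[xs|xt]; split=> //.
    exact: (min_in s t).
  apply: (min_in t s) => //; first exact: same_sum_prod_sym.
  by move=> y; rewrite mem_cat orbC -mem_cat; apply: x_min.
have [xs xt] := xst.
by apply: (perm_common_elt _ xs xt st); apply/pos/s_pow.
Qed.

Local Open Scope ring_scope.

(** * Cospectral normal matrices *)

(** The permutation of positions relating the two value lists is carried to the index types through
    their enumerations. It serves for eigenvalues, for class sizes and for vertex classes. *)
Lemma perm_codom_bij (V W : finType) (T : eqType) (c : W -> T) (d : V -> T) :
  perm_eq (codom c) (codom d) ->
  exists2 f : W -> V, bijective f & forall x, d (f x) = c x.
Proof.
move=> cd; have eVW : #|V| = #|W| by move/perm_size: cd; rewrite !size_codom.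
have szd : size (codom d) == #|W| by rewrite size_codom eVW.
have /tuple_permP[s] : perm_eq (codom c) (Tuple szd) by [].
move=> cs.
pose f x := enum_val (cast_ord (esym eVW) (s (enum_rank x))).
have f_inj : injective f.
  by move=> x y /enum_val_inj/cast_ord_inj/perm_inj/enum_rank_inj.
exists f; first by apply: inj_card_bij f_inj _; rewrite eVW.
move=> x; have := congr1 (fun l => nth (c x) l (enum_rank x)) cs.
rewrite nth_codom enum_rankK -tnth_nth tnth_mktuple (tnth_nth (c x)) /= => ->.
exact/esym/(nth_codom _ d (cast_ord (esym eVW) (s (enum_rank x)))).
Qed.

Section Spectral.

(** Similarity preserves the characteristic polynomial, which is read off the diagonal after unitary
    diagonalisation. *)
Lemma spectrum_normal n (A : 'M[algC]_n) : A \is normalmx ->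
  perm_eq (spectrum A) (codom (spectral_diag A 0)).
Proof.
move=> /orthomx_spectralP eA; apply/prod_XsubC_eq.
have Pu := unitarymx_unit (spectral_unitarymx A).
rewrite -spectrumP big_map big_enum /= {1}eA.
set P := spectralmx A in Pu eA *; set d := spectral_diag A.
transitivity (char_poly (diag_mx d)).
  rewrite /char_poly /char_poly_mx.
  have -> : 'X%:M - map_mx polyC (invmx P *m diag_mx d *m P) =
    map_mx polyC (invmx P) *m ('X%:M - map_mx polyC (diag_mx d)) *m map_mx polyC P.
    rewrite mulmxBr mulmxBl !map_mxM /=; congr (_ - _).
    rewrite -mulmxA -scalar_mxC mulmxA -map_mxM mulVmx //.
    by rewrite map_mx1 mul1mx.
  rewrite !det_mulmx mulrAC -det_mulmx -map_mxM mulVmx //.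
  by rewrite map_mx1 det1 mul1r.
rewrite char_poly_trig ?diag_mx_is_trig //.
by apply: eq_bigr => i _; rewrite mxE eqxx mulr1n.
Qed.

Variables (m n : nat) (A : 'M[algC]_m) (B : 'M[algC]_n).
Hypotheses (A_normal : A \is normalmx) (B_normal : B \is normalmx).
Hypothesis AB : perm_eq (spectrum A) (spectrum B).

Let shifted_diag k (C : 'M[algC]_k) : C \is normalmx ->
  C + 1%:M = invmx (spectralmx C)
      *m diag_mx (spectral_diag C + const_mx 1) *m spectralmx C.
Proof.
move=> /orthomx_spectralP eC.
have Pu := unitarymx_unit (spectral_unitarymx C).
rewrite linearD /= diag_const_mx mulmxDr mulmxDl -eC.
by rewrite mulmx1 mulVmx.
Qed.

Let cospectral_bij : exists2 f : 'I_m -> 'I_n, bijective f &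
  forall i, spectral_diag B 0 (f i) = spectral_diag A 0 i.
Proof.
apply: perm_codom_bij; rewrite -(permPl (spectrum_normal A_normal)).
by rewrite -(permPr (spectrum_normal B_normal)).
Qed.

Lemma cospectral_size : m = n.
Proof. by have [f /bij_eq_card] := cospectral_bij; rewrite !card_ord. Qed.

Lemma cospectral_rank : (\rank (A + 1%:M)%R <= \rank (B + 1%:M)%R)%N.
Proof.
have [f f_bij fE] := cospectral_bij.
have unitP k (C : 'M[algC]_k) := unitarymx_unit (spectral_unitarymx C).
rewrite (shifted_diag A_normal) (shifted_diag B_normal).
set D := diag_mx (spectral_diag B + _).
have rankB : \rank (invmx (spectralmx B) *m D *m spectralmx B) = \rank D.
  rewrite mxrankMfree ?row_free_unit // -mxrank_tr trmx_mul.
  by rewrite mxrankMfree ?mxrank_tr // row_free_unit unitmx_tr unitmx_inv.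
(* The shifted diagonal of [A] is that of [B] reindexed by [f], and selecting rows and columns
   cannot raise the rank. *)
have -> : diag_mx (spectral_diag A + const_mx 1) = rowsub f (colsub f D).
  by apply/matrixP=> i j; rewrite !mxE fE (inj_eq (bij_inj f_bij)).
rewrite rankB; apply: leq_trans (mxrankM_maxl _ _) _.
apply: leq_trans (mxrankM_maxr _ _) _.
rewrite rowsubE.
apply: leq_trans (mxrankM_maxr _ _) _; rewrite -{1}[D]mulmx1 -mulmx_colsub.
exact: mxrankM_maxl.
Qed.

(** By cyclicity of the trace, both sides are the sum of $(\lambda+1)^3$ over the common
    spectrum. *)
Lemma cospectral_trace_cube :
  \tr ((A + 1%:M) *m (A + 1%:M) *m (A + 1%:M)) =
  \tr ((B + 1%:M) *m (B + 1%:M) *m (B + 1%:M)).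
Proof.
have [f f_bij fE] := cospectral_bij.
have traceE k (C : 'M[algC]_k) : C \is normalmx ->
    \tr ((C + 1%:M) *m (C + 1%:M) *m (C + 1%:M)) =
    \sum_i (spectral_diag C 0 i + 1) ^+ 3.
  move=> nC; rewrite (shifted_diag nC).
  have Pu := unitarymx_unit (spectral_unitarymx C).
  set P := spectralmx C in Pu *; set D := diag_mx _.
  rewrite !mulmxA !(mulmxK Pu) mxtrace_mulC !mulmxA (mulmxV Pu) mul1mx.
  rewrite !mulmx_diag mxtrace_diag.
  by apply: eq_bigr => i _; rewrite !mxE !exprS expr0 mulr1 mulrA.
rewrite !traceE // (reindex f) /=; last exact: onW_bij.
by apply: eq_bigr => i _; rewrite fE.
Qed.
End Spectral.

(** * Sign matrices of rank at most three *)

Lemma rows_span n (M : 'M[algC]_n) (f : 'I_3 -> 'I_n) :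
  (\rank M <= 3)%N -> row_free (rowsub f M) ->
  forall x, exists a : 'I_3 -> algC, forall j, M x j = \sum_k a k * M (f k) j.
Proof.
move=> rkM /eqP freeN x.
have sNM : (rowsub f M <= M)%MS by rewrite rowsubE submxMl.
have : (M <= rowsub f M)%MS.
  have := mxrank_leqif_sup sNM; rewrite freeN => /geq_leqif.
  by rewrite rkM => <-.
move=> /(submx_trans (row_sub x M)) /submxP[a ea].
exists (fun k => a 0 k) => j.
have := congr1 (fun v : 'rV__ => v 0 j) ea; rewrite !mxE => ->.
by apply: eq_bigr => k _; rewrite !mxE.
Qed.

(** The three indices have the shapes that [sum3] produces, so case analysis and expanded sums agree
    syntactically. *)
Lemma ord3P (P : 'I_3 -> Prop) :
  P ord0 -> P (lift ord0 ord0) -> P ord_max -> forall k, P k.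
Proof.
move=> P0 P1 P2 [[|[|[|//]]] lt_k].
- by rewrite (_ : Ordinal _ = ord0) //; apply: val_inj.
- by rewrite (_ : Ordinal _ = lift ord0 ord0) //; apply: val_inj.
- by rewrite (_ : Ordinal _ = ord_max) //; apply: val_inj.
Qed.

Lemma sum3 (R : nmodType) (F : 'I_3 -> R) :
  \sum_i F i = F ord0 + F (lift ord0 ord0) + F ord_max.
Proof.
rewrite !big_ord_recr big_ord0 /= add0r.
by congr (F _ + F _ + F _); apply: val_inj.
Qed.

Section SignMatrix.

Variable n : nat.
Implicit Types e : rel 'I_n.

(** Edges become $-1$ and non-edges $+1$, as in the Seidel matrix plus the identity. *)
Definition sign_mx e : 'M[algC]_n := \matrix_(i, j) (-1) ^+ e i j.

(** Switching conjugates the sign matrix by a diagonal matrix with entries $\pm 1$. *)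
Lemma sign_mx_switch e (s : 'I_n -> bool) :
  (\rank (sign_mx (fun i j => s i (+) s j (+) e i j)) <= \rank (sign_mx e))%N.
Proof.
pose D : 'M[algC]_n := diag_mx (\row_i (-1) ^+ s i).
have -> : sign_mx (fun i j => s i (+) s j (+) e i j) = D *m sign_mx e *m D.
  apply/matrixP=> i j; rewrite mul_mx_diag mul_diag_mx !mxE !signr_addb.
  by rewrite mulrAC.
exact: leq_trans (mxrankM_maxl _ _) (mxrankM_maxr _ _).
Qed.

Section Normalised.
Variables (e : rel 'I_n) (f : 'I_3 -> 'I_n).
Hypotheses (e_sym : symmetric e) (e_irr : irreflexive e).
Hypothesis rank_e : (\rank (sign_mx e) <= 3)%N.
Hypothesis ef : forall k l, e (f k) (f l) = (k != l).

Lemma transversal_free : row_free (rowsub f (sign_mx e)).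
Proof.
(* [C] is the inverse of $2I-J$, the submatrix on the three indices [f k]. *)
pose C : 'M[algC]_3 := 2^-1 *: (1%:M - const_mx 1).
apply/row_freeP; exists (colsub f 1%:M *m C).
rewrite mulmxA mulmx_colsub mulmx1; apply/matrixP=> i j; rewrite !mxE sum3 !mxE !ef.
move: i j; apply: ord3P; apply: ord3P; rewrite /= ?expr0 ?expr1;
  by field.
Qed.

(* If x had equal entries in the three columns f k, its row would be plus or     *)
(* minus the sum of the three rows, and the diagonal entry at x would be -3.     *)
Lemma row_switch x : exists sk : bool * 'I_3,
  forall j, e x j = sk.1 (+) e (f sk.2) j.
Proof.
have [a aE] := rows_span rank_e transversal_free x.
have aE' j : (-1) ^+ e x j = a ord0 * (-1) ^+ e (f ord0) j
    + a (lift ord0 ord0) * (-1) ^+ e (f (lift ord0 ord0)) j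
    + a ord_max * (-1) ^+ e (f ord_max) j.
  by have := aE j; rewrite sum3 !mxE.
move: aE' => {aE}; move: (a _) (a _) (a _) => a2 a1 a0 aE.
have := (aE (f ord0), aE (f (lift ord0 ord0)), aE (f ord_max), aE x).
rewrite !ef e_irr ![e (f _) x]e_sym /= !expr0 !expr1 => -[[[]]].
set b0 := e x _; set b1 := e x _; set b2 := e x _ => E0 E1 E2 Ex.
(* The coefficients solve the system [E0], [E1], [E2]. Unless the three signs are all equal, two
   coefficients vanish and the third is $\pm 1$, so the row of [x] is plus or minus one chosen
   row. *)
have A0 : a0 = - ((-1) ^+ b1 + (-1) ^+ b2) / 2 by rewrite E1 E2; field.
have A1 : a1 = - ((-1) ^+ b0 + (-1) ^+ b2) / 2 by rewrite E0 E2; field.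
have A2 : a2 = - ((-1) ^+ b0 + (-1) ^+ b1) / 2 by rewrite E0 E1; field.
move: Ex aE; rewrite {}A0 {}A1 {}A2 {E0 E1 E2}.
pose o1 : 'I_3 := lift ord0 ord0.
have absurd : 1 != - 3 :> algC by rewrite -subr_eq0 opprK -(natrD _ 1 3) pnatr_eq0.
move: b0 b1 b2 => [] [] []; rewrite ?expr0 ?expr1 => Ex aE.
- by case/eqP: absurd; rewrite [LHS]Ex; field.
- exists (false, ord_max) => j; apply: (@signr_inj algC).
  by rewrite aE signr_addb expr0; field.
- exists (false, o1) => j; apply: (@signr_inj algC).
  by rewrite aE signr_addb expr0 /o1; field.
- exists (true, ord0) => j; apply: (@signr_inj algC).
  by rewrite aE signr_addb expr1; field.
- exists (false, ord0) => j; apply: (@signr_inj algC).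
  by rewrite aE signr_addb expr0; field.
- exists (true, o1) => j; apply: (@signr_inj algC).
  by rewrite aE signr_addb expr1 /o1; field.
- exists (true, ord_max) => j; apply: (@signr_inj algC).
  by rewrite aE signr_addb expr1; field.
- by case/eqP: absurd; rewrite [LHS]Ex; field.
Qed.

(** [row_switch] reduces the row index to one of the three chosen indices and, by symmetry, the
    column index too; [ef] evaluates what remains. *)
Lemma normalised_partition : exists (s : 'I_n -> bool) (c : 'I_n -> 'I_3),
  forall i j, e i j = s i (+) s j (+) (c i != c j).
Proof.
have [g gE] := fin_all_exists row_switch.
exists (fun i => (g i).1), (fun i => (g i).2) => i j.
by rewrite gE e_sym gE ef eq_sym addbA.
Qed.

End Normalised.

Theorem rank3_sign_mx e : symmetric e -> irreflexive e ->
  (\rank (sign_mx e) <= 3)%N ->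
  exists (s : 'I_n -> bool) (c : 'I_n -> 'I_3),
  forall i j, e i j = s i (+) s j (+) (c i != c j).
Proof.
move=> e_sym e_irr rank_e.
have [/existsP[u /existsP[v /existsP[w uvw]]]|no_neg] :=
    boolP [exists u, exists v, exists w, e u v (+) e u w (+) e v w]; last first.
  case: (pickP 'I_n) => [o _|n0]; last first.
    by exists (fun _ => false), (fun _ => ord0) => i; have := n0 i.
  (* Without a negative triple, [e i j] is the sum modulo 2 of [e o i] and [e o j]: the row of a
     fixed [o] is the switching function, and one class suffices. *)
  exists (e o), (fun _ => ord0) => i j; rewrite eqxx addbF.
  apply: contraNeq no_neg => neq.
  apply/existsP; exists o; apply/existsP; exists i; apply/existsP; exists j.
  by move: neq; case: (e i j); case: (e o i); case: (e o j).
have [uv [uw vw]] : u != v /\ u != w /\ v != w.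
  split; [|split]; apply: contraTneq uvw => <-;
    by rewrite e_irr ?[e v u]e_sym ?addbF ?addFb addbb.
(* Switching by [s0] makes the pairs $uv$ and $uw$ edges. The product over the triple is invariant
   and negative, so $vw$ becomes an edge as well. *)
pose s0 x := if x == v then ~~ e u v else if x == w then ~~ e u w else false.
pose f := tnth [tuple u; v; w].
have s0u : s0 u = false by rewrite /s0 (negPf uv) (negPf uw).
have s0v : s0 v = ~~ e u v by rewrite /s0 eqxx.
have s0w : s0 w = ~~ e u w by rewrite /s0 eqxx eq_sym (negPf vw).
pose e' : rel 'I_n := fun i j => s0 i (+) s0 j (+) e i j.
have e'_sym : symmetric e' by move=> i j; rewrite /e' e_sym [s0 i (+) _]addbC.
have e'_irr : irreflexive e' by move=> i; rewrite /e' e_irr addbb.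
have rank_e' := leq_trans (sign_mx_switch e s0) rank_e.
have ef' k l : e' (f k) (f l) = (k != l).
  move: uvw; move: k l; apply: ord3P; apply: ord3P; rewrite /f !(tnth_nth u) /=;
    rewrite ?e'_irr /e' ?s0u ?s0v ?s0w ?[e v u]e_sym ?[e w _]e_sym;
    by case: (e u v); case: (e u w); case: (e v w).
have [s [c sc]] := normalised_partition e'_sym e'_irr rank_e' ef'.
exists (fun i => s i (+) s0 i), c => i j.
have := sc i j; rewrite /e'.
by case: (s0 i); case: (s0 j); case: (e i j); case: (s i); case: (s j);
  case: (c i == c j).
Qed.

End SignMatrix.

(** * Graphs *)

(** The product of three signs is $-1$ exactly when the three classes are distinct, so each of the
    six orderings of distinct classes lowers the full cube by twice the product of the weights. *)
Lemma triangle_sum (R : comNzRingType) (N : 'I_3 -> nat) :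
  let T (k l : 'I_3) : R := (-1) ^+ (k != l) in
  \sum_i (\sum_j (\sum_k T i k * T k j * T j i * (N k)%:R) * (N j)%:R) * (N i)%:R =
  (N ord0 + N (lift ord0 ord0) + N ord_max)%:R ^+ 3
    - 12 * (N ord0 * N (lift ord0 ord0) * N ord_max)%:R.
Proof.
move=> T; rewrite !sum3 /T !eqxx /= !expr0 !expr1.
move: (N _) (N _) (N _) => x y z.
rewrite !natrM !natrD.
move: x%:R y%:R z%:R => {}x {}y {}z; ring.
Qed.

Section Coloured.

Variables (n : nat) (s : 'I_n -> bool) (c : 'I_n -> 'I_3).

(** The complete tripartite graph with parts the fibres of [c], possibly empty, switched by [s]. *)
Definition coloured_rel : rel 'I_n := fun i j => s i (+) s j (+) (c i != c j).

Definition class_sizes : seq nat := [seq #|[pred i | c i == k]| | k : 'I_3].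

Lemma class_sizesE : class_sizes =
  [:: #|[pred i | c i == ord0]|; #|[pred i | c i == lift ord0 ord0]|;
      #|[pred i | c i == ord_max]|].
Proof.
rewrite /class_sizes /image_mem !enum_ordSl enum_ord0 /=.
by congr [:: _; _; #|_|].
Qed.

Lemma sum_class (R : pzSemiRingType) (F : 'I_3 -> R) :
  \sum_i F (c i) = \sum_k F k * #|[pred i | c i == k]|%:R.
Proof.
rewrite (partition_big c xpredT) //=; apply: eq_bigr => k _.
rewrite (eq_bigr (fun _ => F k)) => [|i /eqP-> //].
by rewrite sumr_const mulr_natr.
Qed.

Lemma sumn_class_sizes : sumn class_sizes = n.
Proof.
rewrite sumnE big_image /= -[RHS]card_ord -sum1_card.
rewrite (partition_big c xpredT) //=; apply: eq_bigr => k _.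
by rewrite sum1_card.
Qed.

(** Once the switching is undone, an entry depends only on two classes, so the matrix factors
    through dimension 3. *)
Lemma coloured_rank : (\rank (sign_mx coloured_rel) <= 3)%N.
Proof.
apply: leq_trans (sign_mx_switch _ _) _.
pose B : 'M[algC]_(n, 3) := \matrix_(i, k) (c i == k)%:R.
pose C : 'M[algC]_(3, n) := \matrix_(k, j) (-1) ^+ (k != c j).
suff -> : sign_mx (fun i j => c i != c j) = B *m C.
  exact: leq_trans (mxrankM_maxl _ _) (rank_leq_col _).
apply/matrixP=> i j; rewrite !mxE (bigD1 (c i)) //= !mxE eqxx mul1r.
by rewrite big1 ?addr0 // => k ki; rewrite !mxE eq_sym (negPf ki) mul0r.
Qed.

Lemma coloured_trace_cube : let M := sign_mx coloured_rel in
  \tr (M *m M *m M) = n%:R ^+ 3 - 12 * (\prod_(x <- class_sizes) x)%:R.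
Proof.
move=> M; pose T (k l : 'I_3) : algC := (-1) ^+ (k != l).
(* Around a closed triangle each switching sign occurs twice and cancels, leaving only the
   classes. *)
have -> : \tr (M *m M *m M) =
    \sum_i \sum_j \sum_k T (c i) (c k) * T (c k) (c j) * T (c j) (c i).
  rewrite /mxtrace; apply: eq_bigr => i _; rewrite mxE; apply: eq_bigr => j _.
  rewrite mxE mulr_suml; apply: eq_bigr => k _.
  rewrite !mxE /T -!signr_addb /coloured_rel; congr (_ ^+ nat_of_bool _).
  by case: (s i); case: (s j); case: (s k); case: (c i == c k);
     case: (c k == c j); case: (c j == c i).
pose N k := #|[pred i | c i == k]|.
pose F3 i j := \sum_k T i k * T k j * T j i * (N k)%:R.
pose F2 i := \sum_j F3 i j * (N j)%:R.
transitivity (\sum_i F2 (c i)).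
  apply: eq_bigr => i _.
  transitivity (\sum_j F3 (c i) (c j)); last exact: (sum_class (F3 (c i))).
  apply: eq_bigr => j _.
  exact: (sum_class (fun k => T (c i) k * T k (c j) * T (c j) (c i))).
rewrite (sum_class F2) -[in RHS]sumn_class_sizes class_sizesE.
rewrite !big_cons big_nil muln1 /= addn0 mulnA addnA.
exact: triangle_sum.
Qed.

End Coloured.

(** A bijection [t] first matches classes of equal size; then [t \o c] and [d] take each value
    equally often, which yields the bijection of indices. *)
Lemma class_sizes_bij m n (c : 'I_m -> 'I_3) (d : 'I_n -> 'I_3) :
  perm_eq (class_sizes c) (class_sizes d) ->
  exists2 f : 'I_m -> 'I_n, bijective f &
    forall i j, (d (f i) == d (f j)) = (c i == c j).
Proof.
move=> /perm_codom_bij[t t_bij tE].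
have count_codom k (g : 'I_k -> 'I_3) l :
    count_mem l (codom g) = #|[pred i | g i == l]|.
  by rewrite count_map cardE size_filter -enumT.
have /perm_codom_bij[f f_bij fE] : perm_eq (codom (t \o c)) (codom d).
  have [t' tK t'K] := t_bij.
  apply/allP=> k _; rewrite /= !count_codom -[k]t'K tE; apply/eqP/eq_card => i.
  by rewrite !inE /= (inj_eq (can_inj tK)).
by exists f => // i j; rewrite !fE (inj_eq (bij_inj t_bij)).
Qed.

Section Graph.
Variables (V : finType) (G : sgraph V).

Definition index_adj : rel 'I_#|V| := fun i j => adj G (enum_val i) (enum_val j).

Lemma index_adj_sym : symmetric index_adj.
Proof. by move=> i j; rewrite /index_adj adj_sym. Qed.

Lemma index_adj_irr : irreflexive index_adj.
Proof. by move=> i; rewrite /index_adj adj_irr. Qed.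

Lemma seidel_sign : seidel_mx G + 1%:M = sign_mx index_adj.
Proof.
apply/matrixP=> i j; rewrite !mxE /index_adj; move: (1 *+ (i == j)) => d.
by case: (adj G _ _); rewrite /= ?expr0 ?expr1; ring.
Qed.

Lemma seidel_normal : seidel_mx G \is normalmx.
Proof.
apply: symmetric_normalmx.
  apply/is_hermitianmxP; rewrite expr0 scale1r; apply/matrixP=> i j.
  by rewrite !mxE adj_sym eq_sym.
apply/mxOverP=> i j; rewrite !mxE.
by rewrite !rpredB ?rpredM ?rpred1 ?rpred_nat.
Qed.
End Graph.

Lemma card_enum_val (V : finType) (P : pred V) :
  #|[pred i : 'I_#|V| | P (enum_val i)]| = #|P|.
Proof.
rewrite -[LHS]sum1_card -[RHS]sum1_card.
rewrite [RHS](reindex (fun i : 'I_#|V| => enum_val i)) //.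
exact/onW_bij/enum_val_bij.
Qed.

Lemma class_sizes_tripartite p q r (V := ('I_p + 'I_q + 'I_r)%type) :
  class_sizes (fun i : 'I_#|{: V}| => inord (tripartite_part (enum_val i)))
  = [:: p; q; r].
Proof.
have cE (k : 'I_3) :
    #|[pred i : 'I_#|{: V}| | inord (tripartite_part (enum_val i)) == k]| =
    ((0 == k :> nat) * p + (1 == k :> nat) * q + (2 == k :> nat) * r)%N.
  rewrite (card_enum_val (fun x : V => inord (tripartite_part x) == k)).
  have ordE (m : nat) : (m < 3)%N -> (inord m == k) = (m == k :> nat).
    by move=> lt_m; rewrite -val_eqE /= inordK.
  rewrite -sum1_card big_mkcond !big_sumType /=.
  under eq_bigr do rewrite unfold_in ordE //.
  under [X in (_ + X + _)%N]eq_bigr do rewrite unfold_in ordE //.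
  under [X in (_ + X)%N]eq_bigr do rewrite unfold_in ordE //.
  rewrite !sum_nat_const !card_ord !(mulnC _ (if _ then _ else _)).
  by case: k {ordE} => [[|[|[|//]]] ?].
by rewrite class_sizesE !cE /= !mul0n !mul1n ?addn0.
Qed.

Lemma tripartite_adjE p q r x y : adj (complete_tripartite p q r) x y =
  (inord (tripartite_part x) != inord (tripartite_part y) :> 'I_3).
Proof.
rewrite /= /tripartite_adj -val_eqE /= !inordK //; first by case: y => [[]|].
by case: x => [[]|].
Qed.

Lemma cospectral_tripartite p q r (W : finType) (H : sgraph W) :
  same_seidel_spectrum H (complete_tripartite p q r) ->
  exists (s : 'I_#|W| -> bool) (c : 'I_#|W| -> 'I_3),
    index_adj H =2 coloured_rel s c /\ same_sum_prod [:: p; q; r] (class_sizes c).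
Proof.
set G := complete_tripartite p q r => cosp.
pose d (i : 'I_#|{: 'I_p + 'I_q + 'I_r}|) : 'I_3 :=
  inord (tripartite_part (enum_val i)).
have eGM : sign_mx (index_adj G) = sign_mx (coloured_rel (fun _ => false) d).
  by apply/matrixP=> i j; rewrite !mxE /index_adj tripartite_adjE.
have [nH nG] := (seidel_normal H, seidel_normal G).
have WV := cospectral_size nH nG cosp.
have rankH : (\rank (sign_mx (index_adj H)) <= 3)%N.
  rewrite -seidel_sign; apply: leq_trans (cospectral_rank nH nG cosp) _.
  by rewrite seidel_sign eGM coloured_rank.
have [s [c sc]] := rank3_sign_mx (@index_adj_sym _ H) (@index_adj_irr _ H) rankH.
have eHM : sign_mx (index_adj H) = sign_mx (coloured_rel s c).
  by apply/matrixP=> i j; rewrite !mxE sc.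
exists s, c; split=> //.
rewrite -(class_sizes_tripartite p q r) -/d; split; rewrite ?class_sizesE //.
  by rewrite -!class_sizesE !sumn_class_sizes WV.
rewrite -!class_sizesE; have := cospectral_trace_cube nH nG cosp.
rewrite !seidel_sign eGM eHM !coloured_trace_cube.
move: (\prod_(_ <- _) _)%N (\prod_(_ <- _) _)%N => x y.
(* With equal orders the cubes cancel, and the factor 12 is nonzero in [algC]. *)
rewrite WV => /addrI/oppr_inj/mulfI; rewrite pnatr_eq0 => /(_ isT)/eqP.
by rewrite eqr_nat => /eqP.
Qed.

Lemma coloured_switch_tripartite p q r (W : finType) (H : sgraph W)
    (s : 'I_#|W| -> bool) (c : 'I_#|W| -> 'I_3) :
  index_adj H =2 coloured_rel s c -> perm_eq [:: p; q; r] (class_sizes c) ->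
  exists K : sgraph W,
    switching_equivalent H K /\ isomorphic K (complete_tripartite p q r).
Proof.
move=> sc; rewrite perm_sym -(class_sizes_tripartite p q r).
move=> /class_sizes_bij[f f_bij fE].
(* Switching at the vertices where [s] is true cancels [s] from [coloured_rel], so that adjacency
   means lying in distinct classes. *)
pose U := [set x | s (enum_rank x)].
exists (switch U H); split; first by exists U.
exists (fun x => enum_val (f (enum_rank x))).
  apply: bij_comp; first exact: enum_val_bij.
  by apply: bij_comp => //; exact: enum_rank_bij.
move=> x y; rewrite tripartite_adjE fE /=.
have := sc (enum_rank x) (enum_rank y).
rewrite /index_adj /coloured_rel !enum_rankK /switch_adj !inE => ->.
by case: (s _); case: (s _); case: (c _ == c _).
Qed.

Local Open Scope nat_scope.

Theorem theorem4p3 (p q r : nat) (p_gt0 : 0 < p) (q_gt0 : 0 < q) (r_gt0 : 0 < r) :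
  [\/ p = q /\ q = r,
      exists2 a : nat, prime a &
        exists i j k : nat, [/\ p = a ^ i, q = a ^ j & r = a ^ k]
    | prime (maxn p (maxn q r))] ->
  S_determined (complete_tripartite p q r).
Proof.
move=> cases W H /cospectral_tripartite[s [c [sc sp]]].
apply: (coloured_switch_tripartite sc); move: sp.
case: cases => [[<- <-]|[a a_pr [i [j [k [-> -> ->]]]]]|max_pr].
- exact: perm_constant.
- apply: perm_prime_powers a_pr _ => x; rewrite !inE.
  by case/or3P=> /eqP->; [exists i|exists j|exists k].
- apply: perm_prime_max max_pr _ _ _.
  + by rewrite !inE; lia.
  + by rewrite /=; lia.
  + by rewrite !inE; lia.
Qed.
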